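(* Let $\mathcal{G}$ be a fixed topology (directed or undirected graph) with given leaders, and consider the systems $$\dot x_i(t)=-\sum_{j\in\mathcal{N}(i)}(|a_{ij}|x_i(t)-a_{ij}x_j(t))+b_iu_i(t),\quad i=1,\dots,n,$$ and $$\dot x_i(t)=-\sum_{j\in\mathcal{N}(i)}a_{ij}(x_i(t)-x_j(t))+b_iu_i(t),\quad i=1,\dots,n.$$ These systems are structurally controllable if and only if the topology $\mathcal{G}$ is connected and there are no unaccessible nodes.
   Context: $\mathcal{G}=\{\mathcal{V},\mathcal{E}\}$ with adjacency matrix $A=(a_{ij})$: for directed graphs $a_{ji}\ne0$ iff $(v_i,v_j)\in\mathcal{E}$; for undirected graphs $a_{ij}=a_{ji}\neq0$ iff $v_i,v_j$ are joined by an edge. The edge weights are (nonzero) real numbers. $\mathcal{N}(i)$ is the set of nodes adjacent to $i$. $b_i=1$ if node $i$ is a leader (receives an input) and $b_i=0$ otherwise. A system under a fixed topology is structurally controllable if there is at least one choice of weights such that it is controllable. A node is accessible if there is a path from some input to the node, and unaccessible otherwise.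
   Formalization: ''Connected'' is read as: every (weakly) connected component of G contains a leader. With several leaders ordinary connectedness is not necessary (two isolated leaders give x_i' = u_i, which is controllable); with one leader the two notions agree. *)

(* Defs.v *)
From HB Require Import structures.
From mathcomp Require Import all_boot all_order all_algebra.
From mathcomp Require Import all_classical all_reals all_analysis.

Set Implicit Arguments.
Unset Strict Implicit.
Unset Printing Implicit Defensive.

Import Order.TTheory GRing.Theory Num.Theory.
Import numFieldNormedType.Exports.
Local Open Scope ring_scope.

Variant graph_kind := Directed | Undirected.

(* [edge G i j] means (v_i, v_j) \in E.  Self-loops are not excluded. *)
Record topology (n : nat) := Topology {
  kind : graph_kind;
  edge : rel 'I_n;
  edge_sym : kind = Undirected -> symmetric edge }.

(* Note the index reversal: [A j i] weighs the edge from i to j. *)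
Definition adjacency_matrix (R : realType) (n : nat) (G : topology n)
    (A : 'M[R]_n) : Prop :=
  (forall i j : 'I_n, (A j i != 0) = edge G i j) /\
  (kind G = Undirected -> forall i j : 'I_n, A i j = A j i).

(* N(i) is the set of in-neighbours.  Adding the out-neighbours would not
   change the sums below, since [A i j = 0] unless [edge G j i]. *)
Definition neighbours (n : nat) (G : topology n) (i : 'I_n) : {set 'I_n} :=
  [set j | edge G j i].

(* The protocols send a state x and an input u to the velocity of the state;
   [u i 0] acts only if i is a leader, as b_i = 1 iff i \in leaders. *)
Definition absolute_protocol (R : realType) (n : nat) (G : topology n)
    (leaders : {set 'I_n}) (A : 'M[R]_n) (x u : 'cV[R]_n) : 'cV[R]_n :=
  \col_i (- \sum_(j in neighbours G i) (`|A i j| * x i 0 - A i j * x j 0)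
          + (i \in leaders)%:R * u i 0).

Definition relative_protocol (R : realType) (n : nat) (G : topology n)
    (leaders : {set 'I_n}) (A : 'M[R]_n) (x u : 'cV[R]_n) : 'cV[R]_n :=
  \col_i (- \sum_(j in neighbours G i) A i j * (x i 0 - x j 0)
          + (i \in leaders)%:R * u i 0).

(* Any state can be steered to any other one in finite time by a continuous
   input.  For the linear systems considered here, asking for two-sided
   derivatives at 0 and T is no restriction: the input is continuous on the
   whole line, so that solutions extend beyond [0, T]. *)
Definition controllable (R : realType) (n : nat)
    (f : 'cV[R]_n -> 'cV[R]_n -> 'cV[R]_n) : Prop :=
  forall x0 x1 : 'cV[R]_n, exists T : R, 0 < T /\
  exists u x : R -> 'cV[R]_n,
    [/\ forall i : 'I_n, continuous (fun t : R => u t i 0),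
        x 0 = x0,
        x T = x1 &
        forall (t : R) (i : 'I_n), 0 <= t <= T ->
          is_derive t (1 : R) (fun s : R => x s i 0) (f (x t) (u t) i 0)].

Definition structurally_controllable (R : realType) (n : nat)
    (G : topology n)
    (sys : 'M[R]_n -> 'cV[R]_n -> 'cV[R]_n -> 'cV[R]_n) : Prop :=
  exists A : 'M[R]_n, adjacency_matrix G A /\ controllable (sys A).

(* The inputs enter at the leaders, so a path from an input to i is a
   (possibly empty) directed path of G from a leader to i. *)
Definition accessible (n : nat) (G : topology n) (leaders : {set 'I_n})
    (i : 'I_n) : Prop :=
  exists2 l, l \in leaders & connect (edge G) l i.

Definition skeleton (n : nat) (G : topology n) : rel 'I_n :=
  [rel i j | edge G i j || edge G j i].

(* Connectedness of a topology with given leaders is leader-follower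
   connectedness: every connected component (weakly connected component, if G
   is directed) contains a leader.  With a single leader this is ordinary
   connectedness, see [leader_connected1].  With several leaders, ordinary
   connectedness is not necessary for controllability: two isolated leaders
   are controllable, as x_i' = u_i. *)
Definition leader_connected (n : nat) (G : topology n)
    (leaders : {set 'I_n}) : Prop :=
  forall i : 'I_n, exists2 l, l \in leaders & connect (skeleton G) l i.

Lemma leader_connected1 (n : nat) (G : topology n) (l : 'I_n) :
  leader_connected G [set l] <->
  (forall i j : 'I_n, connect (skeleton G) i j).
Proof.
have sym : connect_sym (skeleton G).
  by apply: sym_connect_sym => i j; rewrite /skeleton /= orbC.
split=> [lc i j|c i]; last by exists l; rewrite ?inE.
have [_ /set1P -> li] := lc i; have [_ /set1P -> lj] := lc j.
by apply: connect_trans lj; rewrite sym.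
Qed.

(* Main.v *)
(* Both protocols read x' = L x + B u.  An inaccessible node is driven by
   inaccessible nodes only, so by Gronwall these stay at 0 when started there.
   Conversely, positive weights make both L equal to minus the weighted graph
   Laplacian.  Nodes are switched on one by one, each a leader or an
   out-neighbour of an active node, and all edges of the new node z get a
   common small weight e.  If the Kalman condition failed for every e > 0, a
   polynomial row vector v(X), v(0) <> 0, would annihilate all the L(X)^i B.
   By induction v(0) is proportional to the unit row vector at z, so z is not a
   leader, v(X) L(X) is divisible by X, and the quotient at X = 0 vanishes on
   the old nodes.  Since the old L kills constant vectors, summing its old
   coordinates shows that the weights of the edges into z sum to 0: a
   contradiction.
   Under the Kalman condition, if sum_j c_j L^j = 0 then, for any smooth y,
   x = sum_j c_j sum_(i < j) L^(j-1-i) B y^(i) and u = sum_j c_j y^(j) solve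
   the system, and a polynomial y with prescribed derivatives at 0 and 1 steers
   any state to any other one. *)

Require Import Defs.
From mathcomp Require Import all_boot all_order all_algebra.
From mathcomp Require Import all_classical all_reals all_analysis.
From mathcomp Require Import ring lra.

Set Implicit Arguments.
Unset Strict Implicit.
Unset Printing Implicit Defensive.

Import Order.TTheory GRing.Theory Num.Theory.
Import numFieldNormedType.Exports.
Local Open Scope ring_scope.

(** * Sums of squares, Gram matrices and polynomial row vectors *)

Lemma sum_square_eq0 (R : realDomainType) (I : finType) (F : I -> R) :
  \sum_i F i * F i = 0 -> forall i, F i = 0.
Proof.
move=> F0 i; have sq_ge0 j : true -> 0 <= F j * F j by rewrite -expr2 sqr_ge0.
have := psumr_eq0P sq_ge0 F0 (i := i) isT.
by move/eqP; rewrite mulf_eq0 orbb => /eqP.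
Qed.

Lemma row_norm_eq0 (R : realDomainType) n (v : 'rV[R]_n) :
  (v *m v^T) 0 0 = 0 -> v = 0.
Proof.
move=> v0; apply/rowP => j; rewrite mxE; apply: (sum_square_eq0 (F := v 0)).
by rewrite -[RHS]v0 mxE; apply: eq_bigr => k _; rewrite mxE.
Qed.

Lemma exists_nonroot (R : realDomainType) (p : {poly R}) :
  p != 0 -> exists2 e : R, 0 < e & p.[e] != 0.
Proof.
(* These are [size p] distinct positive numbers, more than [p] can have roots. *)
move=> p0; pose rs : seq R := [seq k.+1%:R | k <- iota 0 (size p)].
have [/allP rootp|/allPn[_ /mapP[k _ ->] rootp]] := boolP (all (root p) rs).
  have := max_poly_roots p0 (rs := rs); rewrite size_map size_iota ltnn.
  move/(_ (introT allP rootp)) => absurd; suff: false by [].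
  apply: absurd; rewrite map_inj_uniq ?iota_uniq // => i j /eqP.
  by rewrite eqr_nat => /eqP[].
by exists k.+1%:R.
Qed.

(** The sum is a discrete-time controllability Gramian of ([L], [B]); the diagonal term penalises
    the coordinates outside [S]. The Kalman condition on [S] thus becomes the nonvanishing of one
    determinant, a polynomial in the perturbation parameter. *)
Definition gram (R : pzRingType) n m (L B : 'M[R]_n) (S : {set 'I_n}) :
    'M[R]_n :=
  \sum_(i < m) (L ^+ i *m B) *m (L ^+ i *m B)^T
    + diag_mx (\row_j (j \notin S)%:R).

(** [v *m gram m L B S *m v^T] is a sum of squares, so all of its terms vanish with it. *)
Lemma gram_ker (R : realDomainType) n m (L B : 'M[R]_n) (S : {set 'I_n})
    (v : 'rV_n) :
  v *m gram m L B S = 0 <->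
  (forall i, (i < m)%N -> v *m (L ^+ i *m B) = 0) /\
  (forall j, j \notin S -> v 0 j = 0).
Proof.
split=> [vG|[vL vS]]; last first.
  rewrite mulmxDr mulmx_sumr big1 => [|i _]; last by rewrite mulmxA vL ?mul0mx.
  rewrite add0r mul_mx_diag; apply/rowP => j; rewrite !mxE.
  by have [jS|/vS ->] := boolP (j \in S); rewrite /= ?mulr0 ?mul0r.
pose w (i : 'I_m) := v *m (L ^+ i *m B).
have: (v *m gram m L B S *m v^T) 0 0 = 0 by rewrite vG mul0mx mxE.
have -> : v *m gram m L B S *m v^T = \sum_i w i *m (w i)^T +
    v *m diag_mx (\row_j (j \notin S)%:R) *m v^T.
  rewrite mulmxDr mulmxDl mulmx_sumr mulmx_suml; congr (_ + _).
  by apply: eq_bigr => i _; rewrite /w (trmx_mul v) !mulmxA.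
rewrite mxE summxE.
have wge0 i : 0 <= (w i *m (w i)^T) 0 0.
  by rewrite mxE sumr_ge0 // => j _; rewrite [_^T _ _]mxE -expr2 sqr_ge0.
pose d j := v 0 j * (j \notin S)%:R.
have -> : (v *m diag_mx (\row_j (j \notin S)%:R) *m v^T) 0 0 =
    \sum_j d j * d j.
  rewrite mul_mx_diag mxE; apply: eq_bigr => j _; rewrite !mxE /d.
  by case: (j \notin S); rewrite ?mulr1 /= ?mulr0 ?mul0r.
have dge0 : 0 <= \sum_j d j * d j.
  by rewrite sumr_ge0 // => j _; rewrite -expr2 sqr_ge0.
have sge0 : 0 <= \sum_i (w i *m (w i)^T) 0 0 by apply: sumr_ge0.
move/eqP; rewrite (paddr_eq0 sge0 dge0) => /andP[/eqP w0 /eqP d0].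
split=> [i im|j jS].
  apply: row_norm_eq0.
  exact: (psumr_eq0P (fun i _ => wge0 i) w0 (i := Ordinal im)).
by have := sum_square_eq0 d0 j; rewrite /d jS mulr1.
Qed.

Lemma map_gram (R S : pzRingType) (f : {rmorphism R -> S}) n m
    (L B : 'M[R]_n) (T : {set 'I_n}) :
  map_mx f (gram m L B T) = gram m (map_mx f L) (map_mx f B) T.
Proof.
rewrite /gram map_mxD map_mx_sum map_diag_mx; congr (_ + diag_mx _).
  apply: eq_bigr => i _; rewrite map_mxM -map_trmx !map_mxM.
  by rewrite (rmorphXn (map_mx f)).
by apply/rowP => j; rewrite !mxE rmorph_nat.
Qed.

(** Divide by ['X] as long as the value at 0 vanishes; each division lowers the total size of the
    entries. *)
Lemma poly_row_divX (R : fieldType) n (v : 'rV[{poly R}]_n) :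
  v != 0 -> exists k (w : 'rV_n),
    v = 'X^k *: w /\ map_mx (horner_eval 0) w != 0.
Proof.
have [s] := ubnP (\sum_j size (v 0%R j)); elim: s v => // s IHs v ltvs v0.
have [vX|] := eqVneq (map_mx (horner_eval 0) v) 0; last first.
  by exists 0%N, v; rewrite expr0 scale1r.
pose w := map_mx (drop_poly 1) v.
have vE : v = 'X *: w.
  apply/rowP => j; rewrite !mxE mulrC -[LHS](poly_take_drop 1) expr1.
  suff -> : take_poly 1 (v 0 j) = 0 by rewrite add0r.
  apply/polyP => -[|i]; rewrite coef_take_poly coef0 //= -horner_coef0.
  by have /rowP/(_ j) := vX; rewrite !mxE.
have w0 : w != 0 by apply: contraNneq v0 => w0; rewrite vE w0 scaler0.
have [|k [u [wE u0]]] := IHs w _ w0; last first.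
  by exists k.+1, u; rewrite vE wE scalerA -exprS.
rewrite ltnS in ltvs; apply: leq_trans ltvs.
have [j vj] : exists j, v 0 j != 0.
  by have [j] := rV0Pn _ v0; exists j.
rewrite (bigD1 j) //= [leqRHS](bigD1 j) //= -addSn leq_add //.
  rewrite mxE size_drop_poly subn1 prednK // lt0n size_poly_eq0 //.
by apply: leq_sum => i _; rewrite mxE size_drop_poly leq_subr.
Qed.

Lemma poly_eq0_pos (R : realDomainType) (p : {poly R}) :
  (forall e, 0 < e -> p.[e] = 0) -> p = 0.
Proof.
move=> pe; apply/eqP/negPn/negP => /exists_nonroot[e e0].
by rewrite pe ?eqxx.
Qed.

(** * The Kalman condition and its perturbation *)

(** The dual form of the Kalman rank condition, restricted to the coordinates in [S]. The number [m]
    of powers is a parameter because each new node is granted one more. *)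
Definition kalman_on (R : realFieldType) n m (L B : 'M[R]_n) (S : {set 'I_n}) :=
  forall v : 'rV_n, (forall j, j \notin S -> v 0 j = 0) ->
    (forall i, (i < m)%N -> v *m (L ^+ i *m B) = 0) -> v = 0.

Lemma map_mx_mul_pow_eq0 (R S : pzRingType) (f : {rmorphism R -> S}) n
    (L B : 'M[R]_n) (w : 'rV_n) i :
  w *m (L ^+ i *m B) = 0 ->
  map_mx f w *m (map_mx f L ^+ i *m map_mx f B) = 0.
Proof.
move=> wLB; rewrite -(rmorphXn (map_mx f)) -!map_mxM wLB.
by rewrite map_mx0.
Qed.

(** If the Gram determinant over the polynomials is nonzero, it is nonzero at some positive [e].
    Otherwise there is a kernel vector, which can be normalised to be nonzero at 0, against the
    hypothesis. *)
Lemma kalman_on_perturb (R : realFieldType) n m (L N B : 'M[R]_n)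
    (S : {set 'I_n}) :
  (forall w : 'rV[{poly R}]_n,
    (forall j, j \notin S -> w 0 j = 0) ->
    (forall i, (i < m)%N ->
       w *m ((map_mx polyC L + 'X *: map_mx polyC N) ^+ i *m map_mx polyC B)
       = 0) ->
    map_mx (horner_eval 0) w = 0) ->
  exists2 e, 0 < e & kalman_on m (L + e *: N) B S.
Proof.
set LX := _ + _; set BX := map_mx polyC B => noker.
have LXe e : map_mx (horner_eval e) LX = L + e *: N.
  by apply/matrixP => i j; rewrite !mxE /horner_eval !hornerE.
have BXe e : map_mx (horner_eval e) BX = B.
  by apply/matrixP => i j; rewrite !mxE /horner_eval !hornerE.
have [/eqP/det0P[v v0 vG]|/exists_nonroot[e e0 detG]] :=
  eqVneq (\det (gram m LX BX S)) 0.
  have [k [w [vE w0]]] := poly_row_divX v0.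
  have wG : w *m gram m LX BX S = 0.
    apply/eqP; rewrite vE -scalemxAl in vG; move/eqP: vG.
    by rewrite scalemx_eq0 expf_eq0 polyX_eq0 andbF.
  (* [gram_ker] needs an ordered ring, so it is applied to the values at each [e] rather than to
     polynomials. *)
  have wGe e : map_mx (horner_eval e) w *m gram m (L + e *: N) B S = 0.
    by rewrite -(LXe e) -(BXe e) -map_gram -map_mxM wG map_mx0.
  suff: map_mx (horner_eval 0) w = 0 by move/eqP; rewrite (negPf w0).
  apply: noker => [j jS|i im].
    apply: poly_eq0_pos => e _.
    have [_ /(_ j jS)] := (gram_ker _ _ _ _ _).1 (wGe e).
    by rewrite mxE.
  apply/rowP => j; rewrite [RHS]mxE; apply: poly_eq0_pos => e _.
  have [/(_ i im)/rowP/(_ j) + _] := (gram_ker _ _ _ _ _).1 (wGe e).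
  rewrite -(LXe e) -{1}(BXe e) -(rmorphXn (map_mx (horner_eval e))).
  by rewrite -!map_mxM !mxE.
exists e => // v vS vL; apply/eqP/negPn/negP => v0.
have vG : v *m gram m (L + e *: N) B S = 0 by apply/gram_ker.
move/negP: detG; apply; rewrite -horner_evalE -det_map_mx map_gram LXe BXe.
by apply/det0P; exists v.
Qed.

(** [L] stands for the Laplacian of the active nodes, [N] for that of the edges at [z]. The
    disjunction separates a follower [z] with incoming edges from a leader [z]. *)
Lemma kalman_on_add (R : realFieldType) n m (L N B : 'M[R]_n)
    (S : {set 'I_n}) (z : 'I_n) :
  (forall j, L z j = 0) -> (forall i j, j \notin S -> L i j = 0) ->
  (forall i, \sum_j L i j = 0) ->
  z \notin S -> (forall i j, j \notin z |: S -> N i j = 0) ->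
  (forall j, B z j = 0) /\ \sum_(j in S) N z j != 0 \/
  (forall v : 'rV_n, v *m B = 0 -> v 0 z = 0) ->
  kalman_on m L B S ->
  exists2 e, 0 < e & kalman_on m.+1 (L + e *: N) B (z |: S).
Proof.
move=> Lz LS L1 zS NS Bz kal; apply: kalman_on_perturb => w wS.
set LX := _ + _; set BX := map_mx polyC B => wL.
have LX0 : map_mx (horner_eval 0) LX = L.
  by apply/matrixP => i j; rewrite !mxE /horner_eval !hornerE.
have BX0 : map_mx (horner_eval 0) BX = B.
  by apply/matrixP => i j; rewrite !mxE /horner_eval !hornerE.
have ev0 k (w' : 'rV_n) : (forall i, (i < k)%N -> w' *m (LX ^+ i *m BX) = 0) ->
    forall i, (i < k)%N ->
    map_mx (horner_eval 0) w' *m (L ^+ i *m B) = 0.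
  move=> wk i ik; rewrite -LX0 -[in X in _ *m (_ *m X)]BX0.
  exact/map_mx_mul_pow_eq0/wk.
set w0 := map_mx (horner_eval 0) w.
have w0S j : j \notin z |: S -> w0 0 j = 0.
  by move=> /wS wj; rewrite mxE wj horner_evalE horner0.
have w0L := ev0 _ _ wL.
(* For a leader [z] the input forces [w0 0 z = 0], and [kal] applies to [w0] itself. *)
case: Bz => [[Bz Nz]|Bz]; last first.
  have wz : w0 0 z = 0 by apply: Bz; rewrite -(w0L 0%N) // expr0 -idmxE mul1mx.
  apply: kal => [j jS|i im]; last by apply: w0L; rewrite ltnW.
  by have [->//|jz] := eqVneq j z; apply: w0S; rewrite !inE negb_or jz.
(* As z is decoupled and has no input, its coordinate is unconstrained. *)
have decoupled (v : 'rV_n) : (forall j, j \notin z |: S -> v 0 j = 0) ->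
    (forall i, (i < m)%N -> v *m (L ^+ i *m B) = 0) ->
    forall j, j != z -> v 0 j = 0.
  move=> vS vL; have zL i : delta_mx 0 z *m (L ^+ i *m B) = 0 :> 'rV_n.
    apply/rowP => j; rewrite -rowE !mxE; case: i => [|i].
      rewrite expr0 -idmxE big1 // => k _; rewrite mxE.
      by case: eqVneq => [<-|_]; rewrite ?Bz ?mulr0 ?mul0r.
    rewrite exprS big1 // => k _; rewrite -mulmxE mxE big1 ?mul0r // => l _.
    by rewrite Lz mul0r.
  pose v' := v - v 0 z *: delta_mx 0 z.
  have /rowP v'0 : v' = 0.
    apply: kal => [j jS|i im]; last first.
      by rewrite mulmxBl vL // -scalemxAl zL scaler0 subr0.
    rewrite !mxE eqxx /=; have [->|jz] := eqVneq j z.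
      by rewrite mulr1 subrr.
    by rewrite mulr0 subr0 vS // !inE negb_or jz.
  by move=> j jz; have := v'0 j; rewrite !mxE eqxx (negPf jz) mulr0 subr0.
have w0z j : j != z -> w0 0 j = 0.
  by apply: decoupled => // i im; apply: w0L; rewrite ltnW.
pose u := map_mx (drop_poly 1) w.
have wE : w = map_mx polyC w0 + 'X *: u.
  apply/rowP => j; rewrite !mxE mulrC -[LHS](poly_take_drop 1) expr1.
  congr (_ + _).
  apply/polyP => -[|i]; rewrite coef_take_poly coefC //=.
  by rewrite horner_evalE horner_coef0.
(* This is the quotient of [w *m LX] by ['X]: the constant term [w0 *m L] vanishes, as [w0] lives at
   [z], where the row of [L] is zero. *)
pose v := u *m map_mx polyC L + w *m map_mx polyC N.
have w0L0 : w0 *m L = 0.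
  apply/rowP => j; rewrite !mxE big1 // => k _.
  by have [->|/w0z ->] := eqVneq k z; rewrite ?Lz ?mulr0 ?mul0r.
have vE : w *m LX = 'X *: v.
  rewrite mulmxDr -scalemxAr {1}wE mulmxDl -map_mxM w0L0 map_mx0 add0r.
  by rewrite -scalemxAl -scalerDr.
have v0L := ev0 m v; set v0 := map_mx _ v in v0L.
(* Multiplying by [LX] uses up one power, hence [m.+1] in the conclusion. *)
have {}v0L i : (i < m)%N -> v0 *m (L ^+ i *m B) = 0.
  apply: v0L => {}i im; apply/eqP; have /eqP := wL i.+1 im.
  by rewrite exprS -mulmxE -mulmxA mulmxA vE -scalemxAl scalemx_eq0 polyX_eq0.
have v0E : v0 = map_mx (horner_eval 0) u *m L + w0 *m N.
  rewrite /v0 /v map_mxD !map_mxM.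
  have mapC (A : 'M[R]_n) : map_mx (horner_eval 0) (map_mx polyC A) = A.
    by apply/matrixP => i j; rewrite !mxE /horner_eval hornerC.
  by rewrite !mapC.
have v0S j : j \notin z |: S -> v0 0 j = 0.
  move=> jS; rewrite v0E !mxE !big1 ?addr0 // => k _.
    by rewrite NS ?mulr0.
  by rewrite LS ?mulr0 //; apply: contraNN jS; rewrite inE orbC => ->.
have v0z := decoupled _ v0S v0L.
have sumL : \sum_(j in S) (map_mx (horner_eval 0) u *m L) 0 j = 0.
  transitivity (\sum_j (map_mx (horner_eval 0) u *m L) 0 j).
    rewrite [RHS](bigID (mem S)) /= [X in _ = _ + X]big1 ?addr0 // => j jS.
    by rewrite mxE big1 // => k _; rewrite LS ?mulr0.
  under eq_bigr do rewrite mxE.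
  by rewrite exchange_big big1 // => k _; rewrite -mulr_sumr L1 mulr0.
(* [v0] is supported at [z], outside [S]. The same sum equals [w0 0 z] times the nonzero sum of the
   [N z j], so [w0 0 z = 0]. *)
have /eqP : \sum_(j in S) v0 0 j = 0.
  by apply: big1 => j jS; apply: v0z; apply: contraNneq zS => <-.
rewrite v0E; under eq_bigr do rewrite mxE.
rewrite big_split /= sumL add0r.
under eq_bigr => j _.
  rewrite mxE (bigD1 z) //= [X in _ + X]big1 => [|k /w0z ->]; last first.
    by rewrite mul0r.
  rewrite addr0; over.
rewrite -mulr_sumr mulf_eq0 (negPf Nz) orbF => /eqP wz.
by apply/rowP => j; rewrite [RHS]mxE; have [->|/w0z] := eqVneq j z.
Qed.

(** * Laplacians and the growth of the set of active nodes *)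

(* The opposite of the usual graph Laplacian. *)
Definition laplacian (R : pzRingType) n (A : 'M[R]_n) : 'M[R]_n :=
  A - diag_mx (\row_i \sum_j A i j).

Lemma laplacianE (R : pzRingType) n (A : 'M[R]_n) i j :
  laplacian A i j = A i j - (\sum_k A i k) *+ (i == j).
Proof. by rewrite !mxE; case: eqVneq => // ->. Qed.

Lemma sum_laplacian (R : pzRingType) n (A : 'M[R]_n) i :
  \sum_j laplacian A i j = 0.
Proof.
under eq_bigr do rewrite laplacianE.
rewrite big_split /= sumrN [X in _ - X](bigD1 i) //= eqxx mulr1n.
rewrite [X in _ - (_ + X)]big1 ?addr0 ?subrr // => j /negPf ji.
by rewrite eq_sym ji.
Qed.

Lemma laplacianD (R : comPzRingType) n (A N : 'M[R]_n) e :
  laplacian (A + e *: N) = laplacian A + e *: laplacian N.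
Proof.
apply/matrixP => i j; rewrite mxE [in RHS]mxE !laplacianE !mxE.
under eq_bigr do rewrite !mxE.
rewrite big_split /= -mulr_sumr.
by case: eqP => _; rewrite ?mulr1n ?mulr0n; ring.
Qed.

Definition leader_mx (R : pzRingType) n (leaders : {set 'I_n}) : 'M[R]_n :=
  diag_mx (\row_j (j \in leaders)%:R).

(** Adjacency matrices of the subgraph induced on [S]. Nonnegativity keeps edges from cancelling
    when weights are added, and makes the two protocols coincide. *)
Definition weights_on (R : realDomainType) n (G : topology n) (S : {set 'I_n})
    (A : 'M[R]_n) :=
  [/\ forall i j, 0 <= A i j,
      forall i j, (A j i != 0) = [&& i \in S, j \in S & edge G i j] &
      kind G = Undirected -> forall i j, A i j = A j i].

Lemma weights_on_add (R : realFieldType) n (G : topology n)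
    (leaders S : {set 'I_n}) m (A : 'M[R]_n) (z : 'I_n) :
  weights_on G S A -> kalman_on m (laplacian A) (leader_mx R leaders) S ->
  z \notin S -> z \in leaders \/ (exists2 j, j \in S & edge G j z) ->
  exists A' : 'M[R]_n, weights_on G (z |: S) A' /\
    kalman_on m.+1 (laplacian A') (leader_mx R leaders) (z |: S).
Proof.
move=> [A0 AS Asym] kal zS zGS.
(* The edges of [z |: S] that enter or leave [z], a loop at [z] included. *)
pose new i j :=
  [&& (i == z) || (j == z), i \in z |: S, j \in z |: S & edge G j i].
pose N : 'M[R]_n := \matrix_(i, j) (new i j)%:R.
have A_out i j : (i \notin S) || (j \notin S) -> A i j = 0.
  move=> ijS; apply/eqP/negPn; rewrite AS.
  by case/orP: ijS => /negPf ->; rewrite ?andbF.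
have N_out i j : (i \notin z |: S) || (j \notin z |: S) -> N i j = 0.
  by move=> ijS; rewrite mxE /new; case/orP: ijS => /negPf ->; rewrite ?andbF.
have N0 i j : 0 <= N i j by rewrite mxE ler0n.
have lap_out (T : {set 'I_n}) (M : 'M[R]_n) :
    (forall i j, (i \notin T) || (j \notin T) -> M i j = 0) ->
    forall i j, (i \notin T) || (j \notin T) -> laplacian M i j = 0.
  move=> MT i j ijT; rewrite laplacianE MT // sub0r.
  have [ij|_] := eqVneq i j; last by rewrite oppr0.
  move: ijT; rewrite ij orbb => jT.
  by rewrite mulr1n big1 ?oppr0 // => k _; rewrite MT ?jT.
have [e e0 kal'] : exists2 e, 0 < e &
    kalman_on m.+1 (laplacian A + e *: laplacian N)
      (leader_mx R leaders) (z |: S).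
  apply: kalman_on_add kal => //.
  - by move=> j; apply: lap_out A_out _ _ _; rewrite zS.
  - by move=> i j jS; apply: lap_out A_out _ _ _; rewrite jS orbT.
  - exact: sum_laplacian.
  - by move=> i j jS; apply: lap_out N_out _ _ _; rewrite jS orbT.
  have [zl|zl] := boolP (z \in leaders).
    by right=> v /rowP/(_ z); rewrite mul_mx_diag !mxE zl mulr1.
  left; split=> [j|]; first by rewrite !mxE (negPf zl) mul0rn.
  have [j jS jz] : exists2 j, j \in S & edge G j z.
    by case: zGS => // zl'; rewrite zl' in zl.
  have NE k : k \in S -> laplacian N z k = N z k.
    move=> kS; rewrite laplacianE.
    case: eqVneq => [zk|_]; last by rewrite subr0.
    by rewrite zk kS in zS.
  (* The terms are nonnegative, and the edge from [j] to [z] contributes 1. *)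
  rewrite (eq_bigr _ NE) gt_eqF // (bigD1 j) //= ltr_pwDl ?sumr_ge0 //.
  by rewrite mxE /new eqxx !inE eqxx jS jz orbT ltr01.
exists (A + e *: N); rewrite laplacianD; split=> //; split=> [i j|i j|uG i j].
- by rewrite !mxE addr_ge0 // mulr_ge0 // ?ler0n // ltW.
- have eN : 0 <= e * N j i by rewrite mulr_ge0 ?N0 ?(ltW e0).
  rewrite mxE [X in _ + X]mxE paddr_eq0 // negb_and AS mulf_eq0 gt_eqF //=.
  rewrite mxE pnatr_eq0 eqb0 negbK /new !inE.
  have [->|iz] := eqVneq i z; have [->|jz] := eqVneq j z;
    by rewrite /= ?(negPf zS) ?orbF ?andbF.
- rewrite !mxE Asym // /new (edge_sym uG j i) orbC; congr (_ + _ * _%:R).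
  by case: (edge G i j); rewrite ?andbF // !andbT [(i \in _) && _]andbC.
Qed.

(** On a path from a leader to a node outside [S], the first node outside [S] is that leader or is
    entered from [S]. *)
Lemma accessible_frontier n (G : topology n) (leaders S : {set 'I_n}) :
  (forall i, accessible G leaders i) -> S != [set: 'I_n] ->
  exists2 z, z \notin S & z \in leaders \/ (exists2 j, j \in S & edge G j z).
Proof.
move=> acc; rewrite -finset.subTset => /subsetPn[i _ iS].
have [l ll /connectP[p pth ip]] := acc i.
have [lS|lS] := boolP (l \in S); last by exists l => //; left.
elim: p l lS pth ip {ll} => [|k p IHp] l lS /= => [_ il|/andP[lk pth] ip].
  by rewrite il lS in iS.
have [kS|kS] := boolP (k \in S); first exact: IHp kS pth ip.
by exists k => //; right; exists l.
Qed.

Lemma accessible_kalman (R : realFieldType) n (G : topology n)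
    (leaders : {set 'I_n}) :
  (forall i, accessible G leaders i) ->
  exists m (A : 'M[R]_n), weights_on G [set: 'I_n] A /\
    kalman_on m (laplacian A) (leader_mx R leaders) [set: 'I_n].
Proof.
move=> acc.
suff grow (S : {set 'I_n}) m (A : 'M[R]_n) : weights_on G S A ->
    kalman_on m (laplacian A) (leader_mx R leaders) S ->
    exists m (A : 'M[R]_n), weights_on G [set: 'I_n] A /\
      kalman_on m (laplacian A) (leader_mx R leaders) [set: 'I_n].
  (* Over the empty set no powers are needed: only the zero vector is supported there. *)
  apply: (grow finset.set0 0%N (0 : 'M[R]_n)).
    by split=> *; rewrite !mxE // !inE eqxx.
  by move=> v v0 _; apply/rowP => j; rewrite v0 ?mxE ?inE.
have [k] := ubnP #|~: S|; elim: k S m A => // k IHk S m A ltSk wA kA.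
have [ST|ST] := eqVneq S [set: 'I_n]; first by exists m, A; rewrite -ST.
have [z zS zGS] := accessible_frontier acc ST.
have [A' [wA' kA']] := weights_on_add wA kA zS zGS.
apply: IHk wA' kA'; rewrite ltnS in ltSk; apply: leq_trans ltSk.
apply: proper_card; rewrite finset.setCU properE finset.subsetIr /=.
by apply/subsetPn; exists z; rewrite !inE ?eqxx.
Qed.

(** * Hermite interpolation at 0 and 1 *)

(** Deriving [('X - c%:P) ^+ N.+1 * q] leaves [('X - c%:P) ^+ N] times a factor whose value at [c]
    is [q.[c] *+ N.+1]. *)
Lemma derivn_XsubC_expM (R : comNzRingType) (c : R) N (q : {poly R}) i :
  (i <= N)%N -> ((('X - c%:P) ^+ N * q)^`(i)).[c] = (q.[c] *+ N`!) *+ (i == N).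
Proof.
elim: N q i => [|N IHN] q [|i] // iN.
- by rewrite derivn0 expr0 mul1r.
- by rewrite derivn0 hornerM exprS hornerM !hornerE subrr !mul0r.
rewrite derivSn derivM deriv_exp /= derivXsubC mul1r mulrnAl -mulrnAr exprSr.
rewrite -mulrA -mulrDr IHN // eqSS.
congr (_ *+ _).
by rewrite hornerD hornerM hornerMn !hornerE subrr mul0r addr0 -mulrnA -factS.
Qed.

(** A multiple of [X^N (X - 1)^N] does not affect derivatives of order below [N] at 0 and 1, so a
    linear factor [q] suffices to adjust those of order [N]. *)
Lemma hermite_interpolation (R : numFieldType) (a b : nat -> R) N :
  exists p : {poly R}, forall i, (i < N)%N ->
    p^`(i).[0] = a i /\ p^`(i).[1] = b i.
Proof.
elim: N => [|N [p IHp]]; first by exists 0.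
(* [A] and [C] are the values of [q] at 0 and 1; the sign is the value of [(X - 1)^N] at 0. *)
pose A := (a N - p^`(N).[0]) / (-1) ^+ N / N`!%:R.
pose C := (b N - p^`(N).[1]) / N`!%:R.
pose q : {poly R} := A%:P + (C - A) *: 'X.
exists (p + ('X - 0%:P) ^+ N * (('X - 1%:P) ^+ N * q)) => i.
have fact0 : N`!%:R != 0 :> R by rewrite pnatr_eq0 -lt0n fact_gt0.
have sign0 : (-1) ^+ N != 0 :> R by rewrite signr_eq0.
rewrite ltnS => iN; rewrite derivnD !hornerD derivn_XsubC_expM //.
rewrite mulrCA derivn_XsubC_expM //; move: iN; rewrite leq_eqVlt.
case/predU1P=> [->|iN]; last by rewrite !ltn_eqF // !mulr0n !addr0; exact: IHp.
rewrite eqxx !mulr1n /q !hornerE /=.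
rewrite -(mulr_natr (_ / _)) -(mulr_natr (_ * (A + C - A))); split.
  by rewrite [(-1) ^+ N * _]mulrC mulfK // divfK // addrC subrK.
by rewrite subr0 expr1n mul1r [A + C]addrC addrK divfK // addrC subrK.
Qed.

(** * Flat parametrisation of the solutions *)

(* chain L B y j = sum_(i < j) L^(j-1-i) B (y i) *)
Fixpoint chain (R : pzRingType) n (L B : 'M[R]_n) (y : nat -> 'cV[R]_n) j :
    'cV[R]_n :=
  if j is j'.+1 then L *m chain L B y j' + B *m y j' else 0.

Lemma eq_chain (R : pzRingType) n (L B : 'M[R]_n) y z j :
  (forall i, (i < j)%N -> y i = z i) -> chain L B y j = chain L B z j.
Proof.
elim: j => //= j IHj yz; rewrite yz // IHj // => i ij.
by rewrite yz // ltnS ltnW.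
Qed.

Lemma chainD (R : pzRingType) n (L B : 'M[R]_n) y z j :
  chain L B (fun i => y i + z i) j = chain L B y j + chain L B z j.
Proof.
elim: j => [|j /= ->]; first by rewrite addr0.
by rewrite !mulmxDr addrACA.
Qed.

Lemma chain0 (R : pzRingType) n (L B : 'M[R]_n) j :
  chain L B (fun=> 0) j = 0.
Proof. by elim: j => //= j ->; rewrite !mulmx0 addr0. Qed.

(** The shifted sum misses only the term in [y 0%N]. Weighted by the [c j], these missing terms add
    up to zero in [flat_shift]. *)
Lemma chain_shift (R : pzRingType) n (L B : 'M[R]_n) y j :
  chain L B (fun i => y i.+1) j = chain L B y j.+1 - L ^+ j *m B *m y 0%N.
Proof.
elim: j => [|j IHj].
  by rewrite /= mulmx0 add0r expr0 -idmxE mul1mx subrr.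
rewrite [LHS]/= IHj mulmxBr exprS -mulmxE !mulmxA [in RHS]/=.
by rewrite addrAC.
Qed.

Lemma map_chain (R S : pzRingType) (f : {rmorphism R -> S}) n
    (L B : 'M[R]_n) y j :
  map_mx f (chain L B y j) =
  chain (map_mx f L) (map_mx f B) (fun i => map_mx f (y i)) j.
Proof.
elim: j => [|j IHj]; first exact: map_mx0.
by rewrite /= map_mxD !map_mxM IHj.
Qed.

(** This is Cayley-Hamilton, except for [n = 0], where the characteristic polynomial has degree 0
    and [N = 1] is taken. *)
Lemma annihilating_poly (R : fieldType) n (L : 'M[R]_n) :
  exists N (c : nat -> R),
    [/\ (0 < N)%N, c N = 1 & \sum_(j < N.+1) c j *: L ^+ j = 0].
Proof.
case: n L => [|n] L.
  by exists 1%N, (fun=> 1); split=> //; rewrite (flatmx0 (\sum__ _)) flatmx0.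
exists n.+1, (fun j => (char_poly L)`_j); split=> //.
  by have /monicP := char_poly_monic L; rewrite /lead_coef size_char_poly.
rewrite -[RHS](Cayley_Hamilton L) -[in RHS](coefK (char_poly L)) poly_def.
rewrite rmorph_sum size_char_poly; apply: eq_bigr => j _.
rewrite /= -mul_polyC rmorphM rmorphXn /= horner_mx_C horner_mx_X.
by rewrite -mul_scalar_mx.
Qed.

Section Flatness.
Variables (R : comNzRingType) (n : nat) (L B : 'M[R]_n).
Variables (N : nat) (c : nat -> R).
Hypotheses (N_gt0 : (0 < N)%N) (cN : c N = 1).
Hypothesis cL : \sum_(j < N.+1) c j *: L ^+ j = 0.

(** [y] plays the flat output with its successive derivatives, so shifting [y] is differentiation
    and [flat y] is the state. The ring is general enough to cover both polynomials in time and
    their values. *)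
Let flat (y : nat -> 'cV[R]_n) := \sum_(j < N.+1) c j *: chain L B y j.

Lemma flatD y z : flat (fun i => y i + z i) = flat y + flat z.
Proof.
by rewrite -big_split; apply: eq_bigr => j _; rewrite chainD scalerDr.
Qed.

Lemma flat_shift y : flat (fun i => y i.+1) =
  L *m flat y + B *m (\sum_(j < N.+1) c j *: y j).
Proof.
have -> : flat (fun i => y i.+1) = \sum_(j < N.+1) c j *: chain L B y j.+1 -
    (\sum_(j < N.+1) c j *: L ^+ j) *m B *m y 0%N.
  rewrite !mulmx_suml -sumrB; apply: eq_bigr => j _.
  by rewrite chain_shift scalerBr -!scalemxAl.
rewrite cL !mul0mx subr0 /flat !mulmx_sumr -big_split.
by apply: eq_bigr => j _; rewrite /= scalerDr !scalemxAr.
Qed.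

(** Put [xi] at index [N.-1]: among the chains up to [N], only the last one reads it, with
    coefficient [c N = 1]. *)
Lemma flat_input xi : exists y, B *m xi = flat y.
Proof.
exists (fun i => if i == N.-1 then xi else 0).
have chain_lt j : (j < N)%N ->
    chain L B (fun i => if i == N.-1 then xi else 0) j = 0.
  move=> jN; rewrite -[RHS](chain0 L B j); apply: eq_chain => i ij.
  by rewrite ltn_eqF // (leq_trans ij) // -ltnS prednK.
rewrite /flat big_ord_recr /= big1 => [|j _]; last by rewrite chain_lt ?scaler0.
rewrite add0r cN scale1r -[in RHS](prednK N_gt0) /= eqxx chain_lt ?prednK //.
by rewrite mulmx0 add0r.
Qed.

(* [y N] does not enter [flat y] and may be chosen to cancel the input. *)
Lemma flat_mul y : exists z, L *m flat y = flat z.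
Proof.
pose y' i := if i == N then - \sum_(j < N) c j *: y j else y i.
exists (fun i => y' i.+1); rewrite flat_shift.
have -> : \sum_(j < N.+1) c j *: y' j = 0.
  rewrite big_ord_recr /= /y' eqxx cN scale1r.
  under eq_bigr => j _ do rewrite ltn_eqF //.
  by rewrite subrr.
rewrite mulmx0 addr0; congr (_ *m _); apply: eq_bigr => j _.
congr (_ *: _); apply: eq_chain => i ij.
by rewrite /y' ltn_eqF // (leq_trans ij) // -ltnS.
Qed.

Lemma flat_pow i xi : exists y, L ^+ i *m B *m xi = flat y.
Proof.
elim: i => [|i [y yE]]; first by rewrite expr0 -idmxE mul1mx; exact: flat_input.
have [z zE] := flat_mul y.
by exists z; rewrite exprS -mulmxE -zE -yE !mulmxA.
Qed.

Lemma flat_sum m (F : 'I_m -> 'cV_n) :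
  (forall i, exists y, F i = flat y) -> exists y, \sum_i F i = flat y.
Proof.
elim: m F => [|m IHm] F FE.
  exists (fun=> 0); rewrite big_ord0 /flat big1 // => j _.
  by rewrite chain0 scaler0.
rewrite big_ord_recr /=; have [z ->] := FE ord_max.
have [y ->] := IHm _ (fun i => FE (widen_ord (leqnSn m) i)).
by exists (fun i => y i + z i); rewrite flatD.
Qed.

End Flatness.

(** The Gram matrix [W] is invertible, and [W *m (invmx W *m x)] is a sum of terms
    [L ^+ i *m B *m xi], each of them flat. *)
Lemma flat_surj (R : realFieldType) n m (L B : 'M[R]_n) N (c : nat -> R) :
  (0 < N)%N -> c N = 1 -> \sum_(j < N.+1) c j *: L ^+ j = 0 ->
  kalman_on m L B [set: 'I_n] ->
  forall x, exists y, x = \sum_(j < N.+1) c j *: chain L B y j.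
Proof.
move=> N0 cN cL kal x; pose W := gram m L B [set: 'I_n].
have Wunit : W \in unitmx.
  rewrite unitmxE unitfE; apply/negP => /det0P[v /eqP v0 /gram_ker[vL vS]].
  exact/v0/kal.
rewrite -[x](mulKVmx Wunit) /W /gram.
have -> : \row_j (j \notin [set: 'I_n])%:R = 0 :> 'rV[R]_n.
  by apply/rowP => j; rewrite !mxE inE.
rewrite linear0 addr0 mulmx_suml; apply: (flat_sum (L := L) (B := B)) => i.
by rewrite -(mulmxA (L ^+ i *m B)); exact: flat_pow.
Qed.

(** * Steering by polynomial trajectories *)

Lemma map_deriv_mulC (R : comNzRingType) m n p (A : 'M[R]_(m, n))
    (Y : 'M[{poly R}]_(n, p)) :
  map_mx deriv (map_mx polyC A *m Y) = map_mx polyC A *m map_mx deriv Y.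
Proof.
apply/matrixP => i j; rewrite !mxE raddf_sum; apply: eq_bigr => k _.
by rewrite /= !mxE derivM derivC mul0r add0r.
Qed.

Lemma deriv_chain (R : comNzRingType) n (L B : 'M[R]_n)
    (Y : 'cV[{poly R}]_n) j :
  map_mx deriv (chain (map_mx polyC L) (map_mx polyC B)
                  (fun i => map_mx (derivn i) Y) j) =
  chain (map_mx polyC L) (map_mx polyC B) (fun i => map_mx (derivn i.+1) Y) j.
Proof.
elim: j => [|j IHj /=]; first by rewrite /= map_mx0.
rewrite map_mxD !map_deriv_mulC IHj; congr (_ + _ *m _).
by apply/matrixP => i k; rewrite !mxE derivnS.
Qed.

Lemma kalman_controllable (R : realType) n m (L B : 'M[R]_n) :
  kalman_on m L B [set: 'I_n] -> controllable (fun x u => L *m x + B *m u).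
Proof.
move=> kal x0 x1; exists 1; split=> //.
have [N [c [N0 cN cL]]] := annihilating_poly L.
have surj := flat_surj N0 cN cL kal.
have [y0 ->] := surj x0; have [y1 ->] := surj x1.
(* Prescribing derivatives of order below [N] is enough: [chain L B y j] with [j <= N] reads [y i]
   only for [i < N]. *)
pose herm i :=
  boolp.cid (hermite_interpolation (fun j => y0 j i 0) (fun j => y1 j i 0) N).
pose Y : 'cV[{poly R}]_n := \col_i projT1 (herm i).
have Y0 j : (j < N)%N -> map_mx (horner_eval 0) (map_mx (derivn j) Y) = y0 j.
  by move=> jN; apply/colP => i; rewrite !mxE; have [] := projT2 (herm i) j jN.
have Y1 j : (j < N)%N -> map_mx (horner_eval 1) (map_mx (derivn j) Y) = y1 j.
  by move=> jN; apply/colP => i; rewrite !mxE; have [] := projT2 (herm i) j jN.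
pose LX := map_mx polyC L; pose BX := map_mx polyC B.
have mapC t (A : 'M[R]_n) : map_mx (horner_eval t) (map_mx polyC A) = A.
  by apply/matrixP => i j; rewrite !mxE /horner_eval hornerC.
have cLX : \sum_(j < N.+1) (c j)%:P *: LX ^+ j = 0.
  rewrite -[RHS](map_mx0 polyC) -cL map_mx_sum; apply: eq_bigr => j _.
  by rewrite map_mxZ /LX rmorphXn.
pose dY i := map_mx (derivn i) Y.
pose X := \sum_(j < N.+1) (c j)%:P *: chain LX BX dY j.
pose U := \sum_(j < N.+1) (c j)%:P *: dY j.
have XE t y : (forall j, (j < N)%N -> map_mx (horner_eval t) (dY j) = y j) ->
    map_mx (horner_eval t) X = \sum_(j < N.+1) c j *: chain L B y j.
  move=> yE; rewrite map_mx_sum; apply: eq_bigr => j _.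
  rewrite map_mxZ /= horner_evalE hornerC map_chain !mapC; congr (_ *: _).
  by apply: eq_chain => i ij; rewrite yE // (leq_trans ij) // -ltnS.
(* The differential equation is proved as an identity of polynomials in time, and evaluated at [t]
   at the end. *)
have dX : map_mx deriv X = LX *m X + BX *m U.
  have -> : map_mx deriv X =
      \sum_(j < N.+1) (c j)%:P *: chain LX BX (fun i => dY i.+1) j.
    rewrite map_mx_sum; apply: eq_bigr => j _.
    by rewrite -deriv_chain -!mul_scalar_mx -map_scalar_mx map_deriv_mulC.
  exact: (flat_shift (c := fun j => (c j)%:P)  BX cLX dY).
exists (fun t => map_mx (horner_eval t) U), (fun t => map_mx (horner_eval t) X).
split=> [i|||t i _]; [|exact: XE|exact: XE|].
  under [X in continuous X]funext do rewrite mxE horner_evalE.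
  exact: continuous_horner.
have -> : (fun s => map_mx (horner_eval s) X i 0) = horner (X i 0).
  by apply/funext => s; rewrite mxE.
apply: trigger_derive.
have := congr1 (map_mx (horner_eval t)) dX.
by rewrite map_mxD !map_mxM !mapC => <-; rewrite !mxE.
Qed.

(** * Necessity of accessibility *)

(** [V t * expR (- C * t)] has nonpositive derivative on [[0, T]]; apply the mean value theorem. *)
Lemma gronwall_le0 (R : realType) (V dV : R -> R) (C T : R) :
  0 < T -> (forall t, 0 <= t <= T -> is_derive t 1 V (dV t)) ->
  (forall t, 0 <= t <= T -> dV t <= C * V t) -> V 0 = 0 -> V T <= 0.
Proof.
move=> T0 VdV dVC V0; pose W t := V t * expR (- C * t).
have WdW t : 0 <= t <= T ->
    is_derive t 1 W ((dV t - C * V t) * expR (- C * t)).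
  move=> /VdV dt; rewrite /W; apply: trigger_derive.
  by rewrite /GRing.scale /=; ring.
have [t t0T|t|c] := @MVT_segment _ W
    (fun t => (dV t - C * V t) * expR (- C * t)) _ _ (ltW T0).
- by apply: WdW; move: t0T; rewrite in_itv /= => /andP[/ltW -> /ltW ->].
- apply: derivable_within_continuous => {}t; rewrite in_itv /= => /WdW dW.
  exact: (@ex_derive _ _ _ _ _ _ _ dW).
rewrite in_itv /= => c0T WT.
have: W T <= 0.
  rewrite -[W T]subr0 -[X in _ - X](_ : W 0 = 0); last by rewrite /W V0 mul0r.
  rewrite WT subr0 mulr_le0_ge0 ?(ltW T0) // mulr_le0_ge0 ?expR_ge0 //.
  by rewrite subr_le0 dVC.
by rewrite /W pmulr_lle0 ?expR_gt0.
Qed.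

(** Steering 0 to the all-ones state is impossible if [S] is nonempty: the squared norm [V] of the
    coordinates in [S] satisfies [V' <= C V], so it cannot leave 0. *)
Lemma autonomous_not_controllable (R : realType) n
    (f : 'cV[R]_n -> 'cV[R]_n -> 'cV[R]_n) (L : 'M[R]_n) (S : {set 'I_n}) :
  (forall x u i, i \in S -> f x u i 0 = \sum_(j in S) L i j * x j 0) ->
  controllable f -> S = finset.set0.
Proof.
move=> fS ctrl; apply/eqP/negPn/negP => /set0Pn[i0 i0S].
have [T [T0 [u [x [_ x0 xT dx]]]]] := ctrl 0 (const_mx 1).
pose V t := \sum_(i in S) x t i 0 ^+ 2.
pose dV t := \sum_(i in S) \sum_(j in S) L i j * (2 * (x t i 0 * x t j 0)).
(* From [|2 a b| <= a^2 + b^2 <= 2 V]. *)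
pose C := \sum_(i in S) \sum_(j in S) `|L i j| * 2.
have le_V t i : i \in S -> x t i 0 ^+ 2 <= V t.
  move=> iS; rewrite /V (bigD1 i) //= lerDl sumr_ge0 // => j _.
  exact: sqr_ge0.
have: V T <= 0.
  apply: (@gronwall_le0 _ V dV C) => // [t t0T|t t0T|]; last first.
  - by rewrite /V x0 big1 // => i _; rewrite mxE expr0n.
  - rewrite /dV /C mulr_suml; apply: ler_sum => i iS; rewrite mulr_suml.
    apply: ler_sum => j jS; rewrite -mulrA.
    apply: le_trans (ler_norm _) _; rewrite normrM ler_wpM2l //.
    have := le_V t i iS; have := le_V t j jS; move: (x t i 0) (x t j 0) (V t).
    move=> a b v bv av; rewrite ler_norml; apply/andP; split; nra.
  (* Padding with zeros gives a sum over all [i < n], the form used by [is_derive_sum]. *)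
  pose h i s := x s i 0 ^+ 2 *+ (i \in S).
  have -> : V = \sum_(i < n) h i.
    apply/funext => s; rewrite fct_sumE /V /h big_mkcond; apply: eq_bigr => i _.
    by case: (i \in S).
  have -> : dV t = \sum_(i < n)
      (\sum_(j in S) L i j * (2 * (x t i 0 * x t j 0))) *+ (i \in S).
    by rewrite /dV big_mkcond; apply: eq_bigr => i _; case: (i \in S).
  apply: is_derive_sum => i; rewrite /h.
  have [iS|_] := boolP (i \in S); last exact: is_derive_cst.
  have dxi := dx t i t0T; rewrite fS // in dxi.
  have -> : (fun s => x s i 0 ^+ 2 *+ true) = (fun s => x s i 0) ^+ 2.
    by apply/funext => s; rewrite fctE.
  apply: trigger_derive; rewrite /GRing.scale /= mulr1n mulr_sumr.
  by apply: eq_bigr => j _; ring.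
apply/negP; rewrite -ltNge (lt_le_trans _ (le_V T i0 i0S)) //.
by rewrite xT mxE expr1n ltr01.
Qed.

(** The matrix [c] covers both protocols: its entries are the weights for the relative one, their
    absolute values for the absolute one. Inaccessible nodes form an autonomous set, containing no
    leader and closed under in-neighbours. *)
Lemma protocol_accessible (R : realType) n (G : topology n)
    (leaders : {set 'I_n}) (A c : 'M[R]_n) (f : 'cV_n -> 'cV_n -> 'cV_n) :
  adjacency_matrix G A ->
  (forall x u i, f x u i 0 =
    - \sum_(j in neighbours G i) (c i j * x i 0 - A i j * x j 0)
    + (i \in leaders)%:R * u i 0) ->
  controllable f ->
  forall i, accessible G leaders i.
Proof.
move=> [AG _] fE ctrl i; apply: contrapT => iacc.
pose S := [set j | `[< ~ accessible G leaders j >]]%SET.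
pose L : 'M[R]_n := A - diag_mx (\row_k \sum_(j in neighbours G k) c k j).
suff S0 : S = finset.set0.
  by have : i \in S; [rewrite inE; apply/asboolP|rewrite S0 inE].
apply: (autonomous_not_controllable (L := L)) ctrl => x u k.
rewrite inE => /asboolP kacc; rewrite fE.
have -> : (k \in leaders) = false.
  by apply/negP => kl; apply: kacc; exists k.
have edgeS j : edge G j k -> j \in S.
  move=> jk; rewrite inE; apply/asboolP => -[l ll lj].
  apply: kacc; exists l => //.
  exact: connect_trans lj (connect1 jk).
have A0 j : ~~ edge G j k -> A k j = 0 by rewrite -AG negbK => /eqP.
rewrite mul0r addr0 sumrB opprB -mulr_suml.
have -> : \sum_(j in neighbours G k) A k j * x j 0 =
    \sum_(j in S) A k j * x j 0.
  rewrite [LHS]big_mkcond [RHS]big_mkcond; apply: eq_bigr => j _; rewrite inE.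
  have [jk|jk] := boolP (edge G j k); first by rewrite edgeS.
  by rewrite A0 // mul0r; case: ifP.
have kS : k \in S by rewrite inE; apply/asboolP.
rewrite (bigD1 k kS) /= [RHS](bigD1 k kS) /= [L k k]mxE !mxE eqxx mulr1n.
rewrite addrAC -mulrBl; congr (_ + _); apply: eq_bigr => j /andP[_ jk].
by rewrite !mxE eq_sym (negPf jk) mulr0n subr0.
Qed.

(** * The two protocols *)

Lemma laplacian_controllable (R : realType) n (G : topology n)
    (leaders : {set 'I_n}) m (A : 'M[R]_n) :
  adjacency_matrix G A ->
  kalman_on m (laplacian A) (leader_mx R leaders) [set: 'I_n] ->
  controllable (relative_protocol G leaders A).
Proof.
move=> [AG _] /kalman_controllable; congr controllable.
apply/funext => x; apply/funext => u; apply/colP => i.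
rewrite mul_diag_mx !mxE; congr (_ + _).
have -> : \sum_(j in neighbours G i) A i j * (x i 0 - x j 0) =
    \sum_j A i j * (x i 0 - x j 0).
  rewrite big_mkcond; apply: eq_bigr => j _; rewrite inE; case: ifPn => //.
  by rewrite -AG negbK => /eqP ->; rewrite mul0r.
under eq_bigr => j _ do rewrite laplacianE mulrBl.
under [in RHS]eq_bigr => j _ do rewrite mulrBr.
rewrite !sumrB opprB -mulr_suml; congr (_ - _).
rewrite [LHS](bigD1 i) //= eqxx mulr1n [X in _ + X = _]big1 ?addr0 //.
by move=> j /negPf ji; rewrite eq_sym ji mul0r.
Qed.

Lemma absolute_relative_protocol (R : realType) n (G : topology n)
    (leaders : {set 'I_n}) (A : 'M[R]_n) :
  (forall i j, 0 <= A i j) ->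
  absolute_protocol G leaders A = relative_protocol G leaders A.
Proof.
move=> A0; apply/funext => x; apply/funext => u; apply/colP => i; rewrite !mxE.
congr (- _ + _); apply: eq_bigr => j _.
by rewrite ger0_norm // mulrBr.
Qed.

Theorem theorem3 (R : realType) (n : nat) (G : topology n)
    (leaders : {set 'I_n}) :
  (structurally_controllable G (@absolute_protocol R n G leaders) <->
     leader_connected G leaders /\
     ~ (exists i : 'I_n, ~ accessible G leaders i)) /\
  (structurally_controllable G (@relative_protocol R n G leaders) <->
     leader_connected G leaders /\
     ~ (exists i : 'I_n, ~ accessible G leaders i)).
Proof.
(* A directed path from a leader is also a path of the skeleton. *)
have acc_conn : (forall i, accessible G leaders i) ->
    leader_connected G leaders /\ ~ (exists i, ~ accessible G leaders i).
  move=> acc; split=> [i|[i]]; last by apply; exact: acc.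
  have [l ll li] := acc i; exists l => //; apply: connect_sub li => j k jk.
  by apply: connect1; apply/orP; left.
(* A single nonnegative weight matrix serves both protocols. *)
have suff_ctrl : leader_connected G leaders /\
    ~ (exists i, ~ accessible G leaders i) ->
    exists A : 'M[R]_n, [/\ adjacency_matrix G A,
      controllable (absolute_protocol G leaders A) &
      controllable (relative_protocol G leaders A)].
  move=> [_ nacc].
  have acc i : accessible G leaders i.
    by apply: contrapT => iacc; apply: nacc; exists i.
  have [m [A [[A0 AG Asym] kal]]] := accessible_kalman R acc.
  have adjA : adjacency_matrix G A by split=> // i j; rewrite AG !inE.
  have ctrl := laplacian_controllable adjA kal.
  by exists A; rewrite absolute_relative_protocol.
split; split.
- move=> [A [adjA ctrl]]; apply: acc_conn.
  apply: (protocol_accessible (c := map_mx Num.norm A)) adjA _ ctrl => x u i.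
  by rewrite mxE; congr (- _ + _); apply: eq_bigr => j _; rewrite mxE.
- by move=> /suff_ctrl[A [adjA ? _]]; exists A.
- move=> [A [adjA ctrl]]; apply: acc_conn.
  apply: (protocol_accessible (c := A)) adjA _ ctrl => x u i.
  by rewrite mxE; congr (- _ + _); apply: eq_bigr => j _; rewrite mulrBr.
- by move=> /suff_ctrl[A [adjA _ ?]]; exists A.
Qed.
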